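(* The inequality $$\#\mathcal N_a(x)\ge\frac{x}{48}\,(1+o(1))$$ holds as $x\to\infty$.
   Context: $\sigma(n)=\sum_{d\mid n}d$ denotes the sum of divisors function. For real $x\ge 1$, $\mathcal N_a(x)=\{1\le m\le x: m\ne\sigma(n)-n\text{ for every positive integer } n\}$, where $m$ ranges over integers (the nonaliquot numbers up to $x$). *)

(* Defs.v *)
From mathcomp Require Import all_boot all_order all_algebra archimedean.
From mathcomp Require Import finmap.
From mathcomp Require Import all_classical all_reals.

Set Implicit Arguments.
Unset Strict Implicit.
Unset Printing Implicit Defensive.

Import Order.TTheory GRing.Theory Num.Theory.

Definition sigma (n : nat) : nat := (\sum_(d <- divisors n) d)%N.

(* Truncated subtraction in [sigma n - n] is therefore exact for [0 < n]. *)
Lemma leq_sigma (n : nat) : (0 < n)%N -> (n <= sigma n)%N.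
Proof.
move=> n0; have nd : n \in divisors n by rewrite -dvdn_divisors.
by rewrite /sigma (big_rem n) //= leq_addr.
Qed.

Definition nonaliquot (m : nat) : Prop :=
  forall n : nat, (0 < n)%N -> m <> (sigma n - n)%N.

Definition nonaliquots (R : realType) (x : R) : set nat :=
  [set m : nat | (1 <= m)%N /\ (m%:R <= x)%R /\ nonaliquot m]%classic.

(* [fset_set] sends infinite sets to the empty one; by this lemma the count
   below is the genuine cardinality. *)
Lemma finite_nonaliquots (R : realType) (x : R) :
  finite_set (nonaliquots x).
Proof.
apply: (sub_finite_set _ (finite_II (Num.truncn x).+1)) => m [_ [mx _]] /=.
have x0 : (0 <= x)%R by apply: le_trans mx; rewrite ler0n.
by rewrite ltnS truncn_ge_nat.
Qed.

Definition nonaliquot_count (R : realType) (x : R) : nat :=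
  #|` fset_set (nonaliquots x) |%fset.

(* Main.v *)
Require Import Defs.
From mathcomp Require Import all_boot all_order all_algebra.
From mathcomp Require Import all_classical all_reals all_analysis.
From mathcomp Require Import zify ring lra.

Set Implicit Arguments.
Unset Strict Implicit.
Unset Printing Implicit Defensive.

Import Order.TTheory GRing.Theory Num.Theory.
Import numFieldNormedType.Exports.
Local Open Scope ring_scope.

(** Write [s n = sigma n - n] and let [m <= N] be a multiple of 12 of the form
    [s n]; among the [N/12] multiples of 12, such [m] make up at most
    [N/16 + o(N)], and [1/12 - 1/16 = 1/48].

    If [n] is odd then [sigma n = m + n] is odd, which forces [n = k^2].  For
    [k] prime [m = k + 1], and the primes have density zero; for [k] composite
    a large proper divisor of [n] gives [k^3 <= m^2], so that only
    [O(N^(2/3))] values of [k] occur.  If [n] is even then its divisor [n/2]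
    gives [n <= 2N].  The integers [n] for which 12 does not divide [sigma n]
    have density zero ([density0_sigma12]), so they can be discarded; for the
    others 12 divides [n = sigma n - m], whence [s n >= 4n/3] and
    [n <= 3N/4], and there are at most [N/16] such [n].

    By the divergence of the sum of the reciprocals of the primes and Turan's
    variance bound, almost every [n] has at least [K] prime factors [p > 3]
    dividing it exactly once ([few_exact_divisors]).  Then [2^K] divides
    [sigma n], hence so does 4.  For the prime 3, let [chi] be the nontrivial
    character modulo 3 and [f n] the sum of [chi d] over the divisors [d] of
    [n].  As [chi d] is congruent to [d], [f n] is congruent to [sigma n]
    modulo 3, so [f n] is nonzero whenever 3 does not divide [sigma n]; by
    multiplicativity it is then at least [2^K].  But [f] is nonnegative and
    has mean at most 1, because the partial sums of [chi] are 0 or 1.  So this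
    happens for a proportion at most [2^-K] of the integers. *)

(** * Divisors and the parity of sigma *)

Lemma mem_divisors d n : (0 < n)%N -> (d \in divisors n) = (d %| n)%N.
Proof. by move=> n0; rewrite dvdn_divisors. Qed.

Lemma perm_divisorsM m n : (0 < m)%N -> (0 < n)%N -> coprime m n ->
  perm_eq (divisors (m * n))
          [seq (a * b)%N | a <- divisors m, b <- divisors n].
Proof.
move=> m0 n0 cmn; have mn0 : (0 < m * n)%N by rewrite muln_gt0 m0.
have gcdl a b : (a %| m)%N -> (b %| n)%N -> gcdn (a * b) m = a.
  move=> am bn; have cbm : coprime m b by apply: coprime_dvdr bn cmn.
  by rewrite gcdnC Gauss_gcdl // (gcdn_idPr am).
apply: uniq_perm; first exact: divisors_uniq.
  apply: allpairs_uniq; try exact: divisors_uniq.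
  move=> [a b] [a' b'] /allpairsP [[x y] /= [xm yn [-> ->]]].
  move=> /allpairsP [[x' y'] /= [xm' yn' [-> ->]]] /= e.
  move: xm yn xm' yn'; rewrite !mem_divisors // => xm yn xm' yn'.
  have ex : x = x' by rewrite -(gcdl _ _ xm yn) e gcdl.
  move: e; rewrite -ex => /eqP; rewrite eqn_pmul2l ?(dvdn_gt0 m0) // => /eqP ->.
  by [].
move=> d; rewrite mem_divisors //; apply/idP/allpairsP.
  move=> dmn; exists (gcdn d m, gcdn d n) => /=; rewrite !mem_divisors //.
  rewrite !dvdn_gcdr; split => //; apply/eqP; rewrite eqn_dvd; apply/andP; split.
    by rewrite muln_gcdr dvdn_gcd dvdn_mull // muln_gcdl dvdn_gcd dvdn_mulr.
  rewrite Gauss_dvd ?dvdn_gcdl //.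
  by apply: coprime_dvdl (dvdn_gcdr d m) _; apply: coprime_dvdr (dvdn_gcdr d n) _.
move=> [[a b] /= []]; rewrite !mem_divisors // => am bn ->; exact: dvdn_mul.
Qed.

Lemma sigmaM m n : (0 < m)%N -> (0 < n)%N -> coprime m n ->
  sigma (m * n) = (sigma m * sigma n)%N.
Proof.
move=> m0 n0 cmn; rewrite /sigma (perm_big _ (perm_divisorsM m0 n0 cmn)) /=.
by rewrite big_allpairs_dep big_distrlr.
Qed.

Lemma perm_divisors_pfactor p a : prime p ->
  perm_eq (divisors (p ^ a)) [seq (p ^ i)%N | i <- iota 0 a.+1].
Proof.
move=> pp; apply: uniq_perm; first exact: divisors_uniq.
  by rewrite map_inj_uniq ?iota_uniq //; apply: expnI; apply: prime_gt1.
move=> d; rewrite mem_divisors ?expn_gt0 ?prime_gt0 //.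
apply/dvdn_pfactor/mapP => // -[i]; first by move=> ia ->; exists i; rewrite ?mem_iota.
by rewrite mem_iota => ia ->; exists i.
Qed.

(** Splitting off the full power of the least prime factor: the induction suited
    to multiplicative functions. *)
Lemma pfactor_ind (P : nat -> Prop) :
  P 1%N ->
  (forall p a m, prime p -> (0 < a)%N -> (0 < m)%N -> coprime (p ^ a) m ->
     P m -> P (p ^ a * m)%N) ->
  forall n, (0 < n)%N -> P n.
Proof.
move=> P1 PM n; elim/ltn_ind: n => n IH n0.
have [n1|n1] := leqP n 1; first by have -> : n = 1%N by apply/eqP; rewrite eqn_leq n1.
have pp := pdiv_prime n1; set p := pdiv n in pp.
have [m cpm e] := pfactor_coprime pp n0.
have a0 : (0 < logn p n)%N by rewrite logn_gt0 mem_primes pp n0 pdiv_dvd.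
have m0 : (0 < m)%N by case: (posnP m) e n0 => // -> ->.
rewrite e mulnC; apply: PM => //; first by rewrite coprime_pexpl.
apply: IH => //; rewrite [X in (_ < X)%N]e -{1}(muln1 m) ltn_pmul2l //.
by rewrite -(expn0 p) ltn_exp2l ?prime_gt1.
Qed.

Lemma odd_sigma_pfactor p a : prime p -> odd p -> odd (sigma (p ^ a)) = ~~ odd a.
Proof.
move=> pp op; rewrite /sigma (perm_big _ (perm_divisors_pfactor a pp)) big_map.
elim: a => [|a IH]; first by rewrite big_seq1.
by rewrite -addn1 iotaD big_cat /= big_seq1 add0n oddD IH oddX op orbT addbT.
Qed.

(** At an odd prime power [p^a], [sigma] is a sum of [a + 1] odd terms, so every
    exponent of [n] must be even. *)
Lemma odd_sigma_square n : (0 < n)%N -> odd n -> odd (sigma n) ->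
  exists k, n = (k ^ 2)%N.
Proof.
move: n; apply: pfactor_ind => [|p a m pp a0 m0 cpm IH]; first by exists 1%N.
rewrite sigmaM ?expn_gt0 ?(prime_gt0 pp) // !oddM oddX eqn0Ngt a0 /=.
move=> /andP[op om]; rewrite odd_sigma_pfactor // => /andP[ea os].
have [k ->] := IH om os; exists (p ^ a./2 * k)%N.
by rewrite expnMn -expnM muln2 -{1}(odd_double_half a) (negbTE ea).
Qed.

(** * The divisor sum of the character modulo 3 *)

Definition chi3 (n : nat) : int :=
  if (n %% 3 == 1)%N then 1 else if (n %% 3 == 2)%N then -1 else 0.

Lemma chi3M m n : chi3 (m * n) = chi3 m * chi3 n.
Proof.
rewrite /chi3 -modnMm.
by move: (ltn_pmod m (isT : 0 < 3)%N) (ltn_pmod n (isT : 0 < 3)%N);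
  case: (m %% 3)%N => [|[|[|?]]] //; case: (n %% 3)%N => [|[|[|?]]].
Qed.

(** One sixth of the number of representations of [n] by [x^2 + x y + y^2]. *)
Definition chi3_sum (n : nat) : int := \sum_(d <- divisors n) chi3 d.

Lemma chi3_sumM m n : (0 < m)%N -> (0 < n)%N -> coprime m n ->
  chi3_sum (m * n) = chi3_sum m * chi3_sum n.
Proof.
move=> m0 n0 cmn; rewrite /chi3_sum (perm_big _ (perm_divisorsM m0 n0 cmn)) /=.
rewrite big_allpairs_dep big_distrlr /=.
by apply: eq_bigr => a _; apply: eq_bigr => b _; rewrite chi3M.
Qed.

(** At a prime power this is a sum of consecutive powers of 0, 1 or -1,
    starting with 1. *)
Lemma chi3_sum_ge0 n : (0 < n)%N -> 0 <= chi3_sum n.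
Proof.
move: n; apply: pfactor_ind => [|p a m pp a0 m0 cpm IH]; first by rewrite /chi3_sum big_seq1.
rewrite chi3_sumM ?expn_gt0 ?(prime_gt0 pp) // mulr_ge0 // {IH cpm m0 a0}.
rewrite /chi3_sum (perm_big _ (perm_divisors_pfactor a pp)) big_map.
have chiX i : chi3 (p ^ i) = chi3 p ^+ i.
  by elim: i => // i IH; rewrite expnS chi3M IH exprS.
rewrite (eq_bigr (fun i => chi3 p ^+ i)) => [|i _]; last exact: chiX.
have [->|p2] := eqVneq (chi3 p) (-1); last first.
  apply: sumr_ge0 => i _; rewrite exprn_ge0 //.
  by move: p2; rewrite /chi3; case: ifP => // _; case: ifP.
suff -> : \sum_(i <- iota 0 a.+1) (-1) ^+ i = (~~ odd a)%:R :> int by [].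
elim: a {chiX} => [|a IH]; first by rewrite big_seq1.
rewrite -addn1 iotaD big_cat big_seq1 IH add0n -signr_odd /=.
by case: (odd a).
Qed.

(** The two divisor sums agree modulo 3 term by term. *)
Lemma sigma_chi3_sum n : (0 < n)%N -> (3 %| (sigma n)%:Z - chi3_sum n)%Z.
Proof.
move=> n0; rewrite /sigma /chi3_sum (big_morph Posz PoszD (erefl _)) -sumrB.
apply: rpred_sum => d _; rewrite /chi3.
have := divn_eq d 3; have := ltn_pmod d (isT : 0 < 3)%N.
case: (d %% 3)%N => [|[|[|?]]] //= _ {1}->; rewrite PoszD PoszM.
- by rewrite addr0 subr0 dvdz_mull.
- by rewrite addrK dvdz_mull.
- by rewrite -addrA (_ : Posz 2 - -1 = 3) // rpredD // dvdz_mull.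
Qed.

Lemma chi3_sum_neq0 n : (0 < n)%N -> ~~ (3 %| sigma n)%N -> chi3_sum n != 0.
Proof.
move=> n0; apply: contra => /eqP f0.
by have := sigma_chi3_sum n0; rewrite f0 subr0.
Qed.

(** Partial summation: [chi3] runs through 1, -1, 0, so on consecutive blocks of
    three the sum telescopes. *)
Lemma sum_chi3_le (a : nat -> nat) M :
  (forall i j, (0 < i <= j)%N -> (a j <= a i)%N) ->
  \sum_(1 <= d < (3 * M).+1) chi3 d * (a d)%:Z <= (a 1%N)%:Z.
Proof.
move=> ha.
suff : \sum_(1 <= d < (3 * M).+1) chi3 d * (a d)%:Z <= (a 1%N)%:Z - (a (3 * M).+1)%:Z.
  by lia.
elim: M => [|M IH]; first by rewrite muln0 big_geq // subrr.
rewrite mulnS !addSn add0n 3?big_nat_recr /= //.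
have -> : chi3 (3 * M).+1 = 1 by rewrite /chi3 (_ : (3 * M).+1 %% 3 = 1)%N //; lia.
have -> : chi3 (3 * M).+2 = -1 by rewrite /chi3 (_ : (3 * M).+2 %% 3 = 2)%N //; lia.
have -> : chi3 (3 * M).+3 = 0 by rewrite /chi3 (_ : (3 * M).+3 %% 3 = 0)%N //; lia.
have := ha (3 * M).+2 (3 * M).+4 (ltnW (leqnSn _)).
by move: IH; set s := \sum_(_ <= _ < _) _; rewrite mul1r mulN1r mul0r addr0; lia.
Qed.

Lemma chi3_sum_dvd_sum N n : (0 < n <= N)%N ->
  chi3_sum n = \sum_(1 <= d < N.+1) chi3 d * (d %| n)%N%:Z.
Proof.
move=> /andP[n0 nN]; rewrite /chi3_sum.
rewrite [RHS](eq_bigr (fun d => if (d %| n)%N then chi3 d else 0)); last first.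
  by move=> d _; case: (d %| n)%N; rewrite ?mulr1 ?mulr0.
rewrite -big_mkcond -big_filter; apply: perm_big; apply: uniq_perm.
- exact: divisors_uniq.
- by rewrite filter_uniq ?iota_uniq.
move=> d; rewrite mem_divisors // mem_filter mem_index_iota.
case: (boolP (d %| n)%N) => //= dn.
by rewrite (dvdn_gt0 n0) //= ltnS (leq_trans (dvdn_leq n0 dn)).
Qed.

(** The sum equals that of [chi3 d * (N %/ d)] over [d], to which [sum_chi3_le]
    applies. *)
Lemma sum_chi3_sum_le N : \sum_(1 <= n < N.+1) chi3_sum n <= N%:Z.
Proof.
have NN : (N <= 3 * N)%N by rewrite leq_pmull.
(* The range of [d] is padded to a multiple of 3; the extra terms vanish. *)
rewrite (eq_big_nat _ _ (F2 := fun n =>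
  \sum_(1 <= d < (3 * N).+1) chi3 d * (d %| n)%N%:Z)); last first.
  move=> n /andP[n0 nN]; apply: chi3_sum_dvd_sum.
  by rewrite n0 (leq_trans _ NN) // -ltnS.
rewrite exchange_big /=.
rewrite (eq_bigr (fun d => chi3 d * (N %/ d)%N%:Z)); last first.
  by move=> d _; rewrite -mulr_sumr divn_count_dvd (big_morph Posz PoszD (erefl _)).
rewrite -[X in _ <= Posz X]divn1.
by apply: sum_chi3_le => i j /andP[i0 ij]; apply: leq_div2l.
Qed.

(** * Integers with several exact prime divisors *)

Definition exactly_divides p n := (p %| n)%N && ~~ (p ^ 2 %| n)%N.

Lemma exactly_dividesP p n : prime p -> (0 < n)%N -> exactly_divides p n ->
  exists m, [/\ n = (p * m)%N, (0 < m)%N & coprime p m].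
Proof.
move=> pp n0 /andP[/dvdnP[m en] np2]; exists m; split.
- by rewrite mulnC.
- by move: n0; rewrite en muln_gt0 => /andP[].
- rewrite prime_coprime //; apply: contra np2 => pm.
  by rewrite en expnS expn1 dvdn_pmul2r // prime_gt0.
Qed.

Lemma exactly_divides_cofactor p q m : prime p -> prime q -> p != q ->
  exactly_divides q (p * m) -> exactly_divides q m.
Proof.
move=> pp pq npq; have cqp : coprime q p.
  by rewrite prime_coprime // dvdn_prime2 // eq_sym.
by rewrite /exactly_divides !Gauss_dvdr // coprimeXl.
Qed.

Lemma divisors_sum_prime (V : nmodType) (F : nat -> V) p : prime p ->
  \sum_(d <- divisors p) F d = F 1%N + F p.
Proof.
move=> pp; have := perm_divisors_pfactor 1 pp; rewrite expn1 => h.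
by rewrite (perm_big _ h) big_cons big_seq1 expn0 expn1.
Qed.

(** Each exact prime divisor [p] contributes an even factor [1 + p]. *)
Lemma pow2_dvd_sigma s n : uniq s -> (0 < n)%N ->
  {in s, forall p, [/\ prime p, (3 < p)%N & exactly_divides p n]} ->
  (2 ^ size s %| sigma n)%N.
Proof.
elim: s n => [|p t IH] /=; first by move=> *; rewrite dvd1n.
move=> n /andP[pt ut] n0 H.
have [pp p3 ep] := H p (mem_head _ _).
have [m [en m0 cpm]] := exactly_dividesP pp n0 ep.
rewrite en sigmaM ?(prime_gt0 pp) // expnS dvdn_mul //.
  have -> : sigma p = p.+1 by rewrite /sigma (divisors_sum_prime (V := nat) id pp).
  by rewrite dvdn2 /= negbK; case: (even_prime pp) p3 => // ->.
apply: IH => // q qt; have [pq q3 eq] := H q (mem_behead (s := p :: t) qt).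
split=> //; apply: (exactly_divides_cofactor pp pq); last by rewrite -en.
by apply: contraNneq pt => ->.
Qed.

(** Each exact prime divisor [p] contributes a factor [1 + chi3 p], which is 0 or
    2 as [p != 3], hence 2 because the product is nonzero. *)
Lemma pow2_le_chi3_sum s n : uniq s -> (0 < n)%N -> chi3_sum n != 0 ->
  {in s, forall p, [/\ prime p, (3 < p)%N & exactly_divides p n]} ->
  2 ^+ size s <= chi3_sum n.
Proof.
elim: s n => [|p t IH] /=.
  by move=> n _ n0 f0 _; rewrite expr0; have := chi3_sum_ge0 n0; lia.
move=> n /andP[pt ut] n0 + H.
have [pp p3 ep] := H p (mem_head _ _).
have [m [en m0 cpm]] := exactly_dividesP pp n0 ep.
rewrite en chi3_sumM ?(prime_gt0 pp) // exprS mulf_eq0 negb_or => /andP[fp0 fm0].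
have fp : chi3_sum p = 2.
  have p30 : ~~ (3 %| p)%N by rewrite dvdn_prime2 // neq_ltn p3.
  move: fp0 p30; rewrite /chi3_sum divisors_sum_prime // /dvdn /chi3.
  by move: (ltn_pmod p (isT : 0 < 3)%N); case: (p %% 3)%N => [|[|[|?]]].
rewrite fp ler_pM2l //.
apply: IH => // q qt; have [pq q3 eq] := H q (mem_behead (s := p :: t) qt).
split=> //; apply: (exactly_divides_cofactor pp pq); last by rewrite -en.
by apply: contraNneq pt => ->.
Qed.

(** * Counting *)

Definition cnt (A : pred nat) N := count A (iota 1 N).

Lemma cntE A N : cnt A N = (\sum_(1 <= n < N.+1) A n)%N.
Proof. by rewrite /cnt -sum1_count big_mkcond /index_iota subSS subn0. Qed.

Lemma cnt_dvdn d N : cnt (dvdn d) N = (N %/ d)%N.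
Proof. by rewrite cntE divn_count_dvd. Qed.

Lemma sub_cnt (A B : pred nat) N :
  (forall n, (0 < n <= N)%N -> A n -> B n) -> (cnt A N <= cnt B N)%N.
Proof.
move=> AB; rewrite /cnt -!size_filter uniq_leq_size ?filter_uniq ?iota_uniq //.
by move=> n; rewrite !mem_filter mem_iota add1n ltnS => /andP[/AB + nN] => ->.
Qed.

Lemma cntU (A B : pred nat) N : (cnt (fun n => A n || B n) N <= cnt A N + cnt B N)%N.
Proof. by rewrite /cnt -(count_predUI A B) leq_addr. Qed.

Lemma cnt_has (T : Type) (B : T -> pred nat) s N :
  (cnt (fun n => has (B^~ n) s) N <= \sum_(p <- s) cnt (B p) N)%N.
Proof.
elim: s => [|p s IH]; first by rewrite big_nil leqn0 /cnt count_pred0.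
by rewrite big_cons (leq_trans (cntU (B p) _ N)) // leq_add2l.
Qed.

(** * Divergence of the sum of the reciprocals of the primes *)

(** The [s] of the decomposition [n = r * s^2] with [r] squarefree, when no prime
    factor of [n] exceeds [k]. *)
Definition smooth_root k n := (\prod_(0 <= p < k.+1) p ^ (logn p n)./2)%N.

Lemma smooth_decomp k n : (0 < n)%N -> (forall p, prime p -> (p %| n)%N -> (p <= k)%N) ->
  n = (\prod_(0 <= p < k.+1) p ^ odd (logn p n) * smooth_root k n ^ 2)%N.
Proof.
move=> n0 H; rewrite expnS expn1 /smooth_root -!big_split /=.
have {1}<- : (n`_[pred p | p <= k] = n)%N.
  apply: part_pnat_id; apply/pnatP => // p pp pn; exact: H.
rewrite (widen_partn _ (leq_maxl n k)).
rewrite [LHS](eq_bigl (fun p => true && (p < k.+1)%N)) //.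
rewrite -(big_nat_widen 0 k.+1 _ xpredT) ?ltnS ?leq_maxr //.
by apply: eq_bigr => p _; rewrite -!expnD addnn odd_double_half.
Qed.

(** An integer [n = r * s^2] up to [4^j] without prime factors above [k] is
    determined by [s <= 2^j] and by the set of primes dividing [r]. *)
Lemma cnt_smooth k j :
  (cnt (fun n => all (leq^~ k) (primes n)) (2 ^ j * 2 ^ j)%N
     <= 2 ^ k.+1 * 2 ^ j)%N.
Proof.
set N := (2 ^ j * 2 ^ j)%N; set A := (fun n => _).
have sqP n : (0 < n <= N)%N -> A n -> (0 < smooth_root k n <= 2 ^ j)%N /\
  n = (\prod_(0 <= p < k.+1) p ^ odd (logn p n) * smooth_root k n ^ 2)%N.
  move=> /andP[n0 nN] /allP An.
  have e : n = (\prod_(0 <= p < k.+1) p ^ odd (logn p n) * smooth_root k n ^ 2)%N.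
    by apply: smooth_decomp => // p pp pn; apply: An; rewrite mem_primes pp n0.
  split=> //; move: n0 nN; rewrite {1 2}e muln_gt0 => /andP[r0].
  rewrite expn_gt0 orbF => -> rN; rewrite -leq_sqr -[X in (_ <= X)%N]mulnn.
  by apply: leq_trans rN; rewrite leq_pmull.
pose T := ('I_(2 ^ j) * {set 'I_k.+1})%type.
have j0 : (0 < 2 ^ j)%N by rewrite expn_gt0.
(* The root is shifted by one to fit in ['I_(2 ^ j)]; the index 0 of ['I_k.+1],
   not being prime, is in none of the sets. *)
pose g n : T := (insubd (Ordinal j0) (smooth_root k n).-1,
                 [set i : 'I_k.+1 | odd (logn i n)]).
rewrite /cnt -size_filter.
have -> : (2 ^ k.+1 * 2 ^ j = #|{: T}|)%N.
  by rewrite card_prod card_ord -cardsT -powersetT card_powerset cardsT card_ord mulnC.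
rewrite -(size_map g) cardE; apply: uniq_leq_size => [|x _]; last by rewrite mem_enum.
rewrite map_inj_in_uniq ?filter_uniq ?iota_uniq // => m n.
rewrite !mem_filter !mem_iota !add1n !ltnS.
move=> /andP[Am mN] /andP[An nN] [e1 /setP e2].
have [/andP[rm0 rm] ->] := sqP _ mN Am; have [/andP[rn0 rn] ->] := sqP _ nN An.
move/(congr1 val): e1; rewrite !val_insubd.
rewrite !ifT; [|lia|lia] => e1.
have -> : smooth_root k m = smooth_root k n by lia.
congr (_ * _)%N; apply: eq_big_nat => p /andP[_ pk].
by have := e2 (Ordinal pk); rewrite !inE /= => ->.
Qed.

Definition recip_sum (s : seq nat) : rat := \sum_(p <- s) p%:R^-1.

Definition primes_between T M := [seq p <- index_iota T.+1 M.+1 | prime p].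

Lemma divn_le_quotient N d : (N %/ d)%N%:R <= N%:R / d%:R :> rat.
Proof.
have [->|d0] := posnP d; first by rewrite divn0 invr0 mulr0.
by rewrite ler_pdivlMr ?ltr0n // -natrM ler_nat leq_trunc_div.
Qed.

(** Erdos's argument: with [N = 4^(k+2)], at least half of the integers up to
    [N] have a prime factor above [k] by [cnt_smooth], while their number is
    at most the sum of [N / p] over the primes [p] between [k] and [N]. *)
Lemma half_le_recip_sum k : exists2 M, (k <= M)%N &
  2^-1 <= recip_sum (primes_between k M).
Proof.
pose j := k.+2; pose N := (2 ^ j * 2 ^ j)%N; exists N.
  have : (j < 2 ^ j)%N by rewrite ltn_expl.
  by rewrite /N /j; nia.
set s := primes_between k N.
have H : (N <= 2 ^ k.+1 * 2 ^ j + \sum_(p <- s) (N %/ p))%N.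
  have {1}-> : N = cnt predT N by rewrite /cnt count_predT size_iota.
  apply: leq_trans (leq_add (cnt_smooth k j) _); last first.
    apply: leq_trans (cnt_has (fun p => dvdn p) s N) _.
    by rewrite leq_sum // => p _; rewrite cnt_dvdn.
  apply: leq_trans (cntU _ _ _); apply: sub_cnt => n /andP[n0 nN] _ /=.
  case: (boolP (all _ _)) => //= /allPn[p]; rewrite mem_primes -ltnNge.
  move=> /and3P[pp _ pn] kp; apply/hasP; exists p => //.
  rewrite mem_filter pp mem_index_iota kp /= ltnS.
  by apply: leq_trans nN; apply: dvdn_leq.
have {}H : N%:R <= N%:R / 2 + N%:R * recip_sum s :> rat.
  rewrite /recip_sum mulr_sumr.
  have -> : N%:R / 2 = (2 ^ k.+1 * 2 ^ j)%N%:R :> rat.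
    by rewrite /N {1}/j expnS !natrM; field.
  apply: le_trans (_ : (2 ^ k.+1 * 2 ^ j + \sum_(p <- s) (N %/ p))%N%:R <= _).
    by rewrite ler_nat.
  rewrite natrD lerD2l natr_sum ler_sum // => p _; exact: divn_le_quotient.
have N0 : 0 < N%:R :> rat by rewrite ltr0n /N muln_gt0 expn_gt0.
by rewrite -(ler_pM2l N0); lra.
Qed.

Lemma recip_sum_unbounded T j : exists2 M, (T <= M)%N &
  j%:R / 2 <= recip_sum (primes_between T M).
Proof.
elim: j => [|j [M TM H]].
  by exists T => //; rewrite mul0r sumr_ge0 // => p _; rewrite invr_ge0.
have [M' MM' H'] := half_le_recip_sum M.
exists M'; first exact: leq_trans MM'.
have -> : primes_between T M' = primes_between T M ++ primes_between M M'.
  rewrite /primes_between -filter_cat /index_iota; congr [seq _ <- _ | _].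
  have -> : (M'.+1 - T.+1 = (M.+1 - T.+1) + (M'.+1 - M.+1))%N by lia.
  by rewrite iotaD subnKC.
by rewrite /recip_sum big_cat /=; move: H H'; rewrite /recip_sum; lra.
Qed.

(** Compare [1/p^2] with the telescoping [1/(p-1) - 1/p]. *)
Lemma recip_square_sum_le T M : (0 < T)%N ->
  \sum_(p <- primes_between T M) (p ^ 2)%N%:R^-1 <= T%:R^-1 :> rat.
Proof.
move=> T0; rewrite /primes_between big_filter big_mkcond /=.
apply: (@le_trans _ _ (\sum_(T.+1 <= p < M.+1) ((p.-1)%:R^-1 - p%:R^-1))).
  rewrite !big_nat ler_sum // => -[|[|p]] /andP[pT _]; try lia.
  rewrite [p.+2.-1]/=.
  have p0 : 0 <= p%:R :> rat by [].
  have -> : p.+1%:R^-1 - p.+2%:R^-1 = (p.+1 * p.+2)%N%:R^-1 :> rat.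
    by rewrite natrM; field; lra.
  case: ifP => _; last by rewrite invr_ge0.
  by rewrite lef_pV2 ?posrE ?ltr0n // ler_nat; lia.
have [MT|TM] := leqP M T; first by rewrite big_geq // invr_ge0.
have := @telescope_sumr _ T M (fun i => - i%:R^-1 : rat) (ltnW TM).
rewrite big_add1 /= => E.
rewrite (eq_bigr (fun i => - i.+1%:R^-1 - - i%:R^-1)); last by move=> i _; rewrite opprK addrC.
by rewrite E; have : 0 <= M%:R^-1 :> rat; [rewrite invr_ge0 | lra].
Qed.

(** * Turan's variance bound *)

Lemma sum_dvdn (F : numDomainType) d N :
  \sum_(1 <= n < N.+1) (d %| n)%N%:R = (N %/ d)%N%:R :> F.
Proof. by rewrite divn_count_dvd natr_sum. Qed.

Lemma divn_gt_quotient N d : (0 < d)%N -> N%:R / d%:R - 1 <= (N %/ d)%N%:R :> rat.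
Proof.
move=> d0; rewrite lerBlDr ler_pdivrMr ?ltr0n // natr1 -natrM ler_nat.
by rewrite ltnW // ltn_ceil.
Qed.

Definition deviation (p n : nat) : rat := (p %| n)%N%:R - p%:R^-1.

Lemma sum_deviation_sq p N : (1 < p)%N ->
  \sum_(1 <= n < N.+1) deviation p n * deviation p n <= N%:R / p%:R.
Proof.
move=> p1.
have p0 : 0 < p%:R :> rat by rewrite ltr0n ltnW.
rewrite (eq_bigr (fun n => (p %| n)%N%:R * (1 - 2 / p%:R) + p%:R^-1 ^+ 2)); last first.
  by move=> n _; rewrite /deviation; case: (p %| n)%N => /=; field; lra.
rewrite big_split /= -mulr_suml sum_dvdn sumr_const_nat subn1 /=.
rewrite -[_ ^+ 2 *+ N]mulr_natl.
have i2 : p%:R^-1 <= 2^-1 :> rat.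
  by rewrite lef_pV2 ?posrE ?ltr0n ?(ltnW p1) // ler_nat.
have i0 : 0 < p%:R^-1 :> rat by rewrite invr_gt0.
have := divn_le_quotient N p; have : 0 <= N%:R :> rat by [].
move: i0 i2; move: (p%:R^-1 : rat) ((N %/ p)%N%:R : rat) (N%:R : rat) => i x y.
by nra.
Qed.

(** Divisibility by [p] and by [q] are independent up to rounding errors. *)
Lemma sum_deviation_prod p q N : prime p -> prime q -> p != q ->
  \sum_(1 <= n < N.+1) deviation p n * deviation q n <= 2.
Proof.
move=> pp pq npq.
have cpq : coprime p q by rewrite prime_coprime // dvdn_prime2.
rewrite (eq_bigr (fun n => (p * q %| n)%N%:R - (p %| n)%N%:R / q%:R
    - (q %| n)%N%:R / p%:R + (p%:R^-1 / q%:R))); last first.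
  move=> n _; rewrite /deviation Gauss_dvd // -mulnb natrM.
  by rewrite mulrBl !mulrBr; ring.
rewrite big_split !sumrB -!mulr_suml !sum_dvdn sumr_const_nat subn1 /=.
rewrite -[_ *+ N]mulr_natl.
have [p0 q0] := (prime_gt0 pp, prime_gt0 pq).
have := divn_le_quotient N (p * q); have := divn_gt_quotient N p0.
have := divn_gt_quotient N q0; rewrite natrM invfM.
have i1 r : prime r -> 0 < (r%:R^-1 : rat) <= 1.
  move=> pr; rewrite invr_gt0 ltr0n prime_gt0 // invf_le1 ?ltr0n ?prime_gt0 //.
  by rewrite ler1n prime_gt0.
move: (i1 p pp) (i1 q pq) => {i1}.
move: (p%:R^-1 : rat) (q%:R^-1 : rat) ((N %/ q)%N%:R : rat) ((N %/ p)%N%:R : rat).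
move: ((N %/ (p * q))%N%:R : rat) (N%:R : rat) => c x i j a b.
move=> /andP[i0 i1] /andP[j0 j1].
by nra.
Qed.

(** Expanding the square, the diagonal terms give at most [N / p] each, and the
    other pairs at most 2 each. *)
Lemma turan_variance s N : uniq s -> all prime s ->
  \sum_(1 <= n < N.+1) ((count (dvdn^~ n) s)%:R - recip_sum s) ^+ 2
    <= N%:R * recip_sum s + 2 * (size s)%:R ^+ 2.
Proof.
move=> us /allP ps.
rewrite (eq_bigr (fun n =>
  \sum_(p <- s) \sum_(q <- s) deviation p n * deviation q n)); last first.
  move=> n _; rewrite -big_distrlr /= expr2 /deviation sumrB -natr_sum.
  have <- : count (dvdn^~ n) s = (\sum_(p <- s) (p %| n))%N.
    by rewrite -sum1_count big_mkcond.
  by [].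
rewrite exchange_big /=.
rewrite (eq_bigr (fun p =>
  \sum_(q <- s) \sum_(1 <= n < N.+1) deviation p n * deviation q n)); last first.
  by move=> p _; rewrite exchange_big.
apply: (@le_trans _ _ (\sum_(p <- s) (N%:R / p%:R + 2 * (size s)%:R))).
  rewrite !big_seq ler_sum // => p sp; rewrite (bigD1_seq p) //= lerD //.
    by rewrite sum_deviation_sq // prime_gt1 // ps.
  apply: (@le_trans _ _ (\sum_(q <- s) 2)); last first.
    by rewrite big_const_seq count_predT iter_addr_0 mulr_natr.
  rewrite big_mkcond !big_seq ler_sum // => q sq; case: ifP => // qp.
  by rewrite sum_deviation_prod ?ps // eq_sym.
rewrite big_split /= -mulr_sumr big_const_seq count_predT iter_addr_0 lerD //.
by rewrite -[X in X <= _]mulr_natr -mulrA -expr2.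
Qed.

(** Chebyshev's inequality: fewer than [K] divisors means a deviation of at least
    half the mean. *)
Lemma few_prime_divisors_le s K N : uniq s -> all prime s -> 2 * K%:R <= recip_sum s ->
  (cnt (fun n => (count (dvdn^~ n) s < K)%N) N)%:R * (recip_sum s / 2) ^+ 2
    <= N%:R * recip_sum s + 2 * (size s)%:R ^+ 2.
Proof.
move=> us ps KS; apply: le_trans (turan_variance N us ps).
rewrite cntE natr_sum mulr_suml ler_sum // => n _.
case: ltnP => [lt|_]; last by rewrite mul0r sqr_ge0.
have w0 : 0 <= (count (dvdn^~ n) s)%:R :> rat by [].
have : (count (dvdn^~ n) s)%:R <= K%:R :> rat by rewrite ler_nat ltnW.
by rewrite mul1r; nra.
Qed.

(** * Sets of density zero *)

(** Upper density at most [1/k] for every [k], in a form free of fractions. *)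
Definition density0 (A : pred nat) :=
  forall k, exists N0, forall N, (N0 <= N)%N -> (k * cnt A N <= N)%N.

(** Only primes above [T] are used, so that at most [N / T] integers are
    divisible by the square of one of them; for the others every prime divisor
    in [s] is exact, and [few_prime_divisors_le] applies as soon as the sum of
    reciprocals is large. *)
Lemma few_exact_divisors K k : exists s,
  [/\ uniq s, {in s, forall p, prime p /\ (3 < p)%N} &
   exists N0, forall N, (N0 <= N)%N ->
     (k * cnt (fun n => count (exactly_divides^~ n) s < K)%N N <= N)%N].
Proof.
(* [T >= 2k] and a reciprocal sum of at least [16k] each bound one of the two
   exceptional sets by [N / 2k]; the [2K] is for Chebyshev's inequality. *)
pose T := (2 * k + 3)%N; pose j := (2 * (2 * K + 16 * k + 1))%N.
have [M TM] := recip_sum_unbounded T j; set s := primes_between T M => Sj.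
have us : uniq s by rewrite filter_uniq ?iota_uniq.
have ps : all prime s by apply: filter_all.
have sT p : p \in s -> prime p /\ (T < p)%N.
  by rewrite mem_filter mem_index_iota => /and3P[].
exists s; split => //; first by move=> p /sT[pp Tp]; split => //; rewrite /T in Tp; lia.
exists (2 * size s ^ 2)%N => N N0.
pose A1 n := (count (dvdn^~ n) s < K)%N; pose A2 n := has (fun p => p ^ 2 %| n)%N s.
have sub : (cnt (fun n => count (exactly_divides^~ n) s < K)%N N <= cnt A1 N + cnt A2 N)%N.
  apply: leq_trans (cntU _ _ _); apply: sub_cnt => n _ /=.
  case: (boolP (A2 n)) => [|/hasPn H]; first by rewrite orbT.
  rewrite orbF /A1 => lt; rewrite -(@eq_in_count _ (exactly_divides^~ n)) // => p ps'.
  by rewrite /exactly_divides H // andbT.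
have jE : j%:R = 2 * (2 * K%:R + 16 * k%:R + 1) :> rat.
  by rewrite /j natrM 2!natrD !natrM.
have KS : 2 * K%:R <= recip_sum s.
  by apply: le_trans Sj; rewrite jE; have : 0 <= k%:R :> rat by []; lra.
have kS : 16 * k%:R + 1 <= recip_sum s.
  by apply: le_trans Sj; rewrite jE; have : 0 <= K%:R :> rat by []; lra.
have A1le : k%:R * (cnt A1 N)%:R <= N%:R / 2 :> rat.
  have := few_prime_divisors_le N us ps KS; rewrite -/A1.
  have : 2 * (size s)%:R ^+ 2 <= N%:R :> rat by rewrite -natrX -natrM ler_nat.
  have : 0 <= (size s)%:R ^+ 2 :> rat by rewrite sqr_ge0.
  have k0 : 0 <= k%:R :> rat by [].
  have c0 : 0 <= (cnt A1 N)%:R :> rat by [].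
  move: kS k0 c0; move: (recip_sum s) (k%:R : rat) ((cnt A1 N)%:R : rat) (N%:R : rat).
  move=> S x c y; move: ((size s)%:R ^+ 2 : rat) => z kS x0 c0 z0 zy H.
  (* [H] reads [c * S^2 / 4 <= y * S + 2 * z], and [2 * z <= y <= y * S]. *)
  have S1 : 1 <= S by lra.
  have H1 : (c * S) * S <= (8 * y) * S by nra.
  have S0 : 0 < S by lra.
  rewrite (ler_pM2r S0) in H1; nra.
have A2le : k%:R * (cnt A2 N)%:R <= N%:R / 2 :> rat.
  have : (cnt A2 N)%:R <= N%:R / T%:R :> rat.
    apply: (@le_trans _ _ (\sum_(p <- s) (N %/ p ^ 2)%N%:R)).
      rewrite -natr_sum ler_nat; apply: leq_trans (cnt_has (fun p => dvdn (p ^ 2)) s N) _.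
      by rewrite leq_sum // => p _; rewrite cnt_dvdn.
    apply: le_trans (_ : N%:R * \sum_(p <- s) (p ^ 2)%N%:R^-1 <= _).
      by rewrite mulr_sumr ler_sum // => p _; exact: divn_le_quotient.
    by rewrite ler_wpM2l // recip_square_sum_le // /T; lia.
  rewrite ler_pdivlMr ?ltr0n /T; last by lia.
  by rewrite natrD natrM; have : 0 <= (cnt A2 N)%:R :> rat by []; lra.
rewrite -(ler_nat rat) natrM; have : 0 <= k%:R :> rat by [].
have : (cnt (fun n => count (exactly_divides^~ n) s < K)%N N)%:R <=
  (cnt A1 N)%:R + (cnt A2 N)%:R :> rat by rewrite -natrD ler_nat.
by nra.
Qed.

(** Markov's inequality for [chi3_sum], whose mean is at most 1. *)
Lemma cnt_large_chi3_sum K N :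
  (2 ^ K * cnt (fun n => (2 ^+ K <= chi3_sum n)%R) N <= N)%N.
Proof.
suff : 2 ^+ K * (cnt (fun n => (2 ^+ K <= chi3_sum n)%R) N)%:Z <= N%:Z.
  by rewrite -[2]/(2%N%:Z) -rmorphXn -PoszM.
apply: le_trans (sum_chi3_sum_le N).
rewrite cntE (big_morph Posz PoszD (erefl _)) mulr_sumr !big_nat ler_sum //.
move=> n /andP[n0 _]; case: (boolP (2 ^+ K <= _)) => [h|_]; rewrite ?mulr1 //.
by rewrite mulr0 chi3_sum_ge0.
Qed.

(** For [n] with at least [K] exact prime divisors, 4 divides [sigma n]; if 12
    does not, then neither does 3, and [chi3_sum n] is at least [2 ^ K]. *)
Lemma density0_sigma12 : density0 (fun n => ~~ (12 %| sigma n)%N).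
Proof.
move=> k; pose K := k.+2.
have [s [us sP [N0 HN]]] := few_exact_divisors K (2 * k).
exists N0 => N /HN {}HN.
set A1 := (fun n => _) in HN.
pose A2 n := 2 ^+ K <= chi3_sum n.
have sub : (cnt (fun n => ~~ (12 %| sigma n)%N) N <= cnt A1 N + cnt A2 N)%N.
  apply: leq_trans (cntU _ _ _); apply: sub_cnt => n /andP[n0 _] s12 /=.
  rewrite /A1; case: ltnP => //= large.
  pose t := [seq p <- s | exactly_divides p n].
  have tK : (K <= size t)%N by rewrite size_filter.
  have ut : uniq t by rewrite filter_uniq.
  have tP : {in t, forall p, [/\ prime p, (3 < p)%N & exactly_divides p n]}.
    by move=> p; rewrite mem_filter => /andP[ep /sP[]].
  have s4 : (4 %| sigma n)%N.
    apply: dvdn_trans (pow2_dvd_sigma ut n0 tP).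
    by rewrite -[4%N]/(2 ^ 2)%N dvdn_exp2l // (leq_trans _ tK).
  have f0 : chi3_sum n != 0.
    by apply: chi3_sum_neq0 => //; apply: contra s12 => s3; rewrite (@Gauss_dvd 4 3) // s4.
  by apply: le_trans (pow2_le_chi3_sum ut n0 f0 tP); rewrite ler_weXn2l.
have := cnt_large_chi3_sum K N; rewrite -/A2.
have : (2 * k <= 2 ^ K)%N by rewrite /K expnS leq_mul2l /= ltnW // ltnW // ltn_expl.
by move: sub HN; nia.
Qed.

(** A prime cannot have two distinct exact prime divisors. *)
Lemma density0_prime : density0 prime.
Proof.
move=> k; have [s [us sP [N0 HN]]] := few_exact_divisors 2 k.
exists N0 => N /HN; apply: leq_trans; rewrite leq_mul2l; apply/orP; right.
apply: sub_cnt => q _ pq; rewrite -size_filter ltnS -[1%N]/(size [:: q]).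
apply: uniq_leq_size; first by rewrite filter_uniq.
move=> p; rewrite mem_filter inE => /andP[/andP[pq' _] /sP[pp _]].
by rewrite -dvdn_prime2.
Qed.

(** * Bounds for aliquot sums *)

Lemma sumn_divisors_le_sigma n t : (0 < n)%N -> uniq t -> all (dvdn^~ n) t ->
  (sumn t <= sigma n)%N.
Proof.
move=> n0 ut /allP tn; rewrite sumnE /sigma.
have sub : {subset t <= divisors n} by move=> d /tn; rewrite mem_divisors.
apply: (uniq_sub_le_big leqnn (fun x y => leq_addr y x)) => //.
exact: divisors_uniq.
Qed.

Lemma aliquot_even_le n : (0 < n)%N -> ~~ odd n -> (n <= 2 * (sigma n - n))%N.
Proof.
rewrite -dvdn2 => n0 /dvdnP[k en]; rewrite {n}en in n0 *.
have := @sumn_divisors_le_sigma (k * 2) [:: k * 2; k]%N n0.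
rewrite /= dvdnn dvdn_mulr // inE andbT => /(_ _ isT).
by lia.
Qed.

(** [1/2 + 1/3 + 1/4 + 1/6 + 1/12 = 4/3]. *)
Lemma aliquot_dvd12_le n : (0 < n)%N -> (12 %| n)%N -> (4 * n <= 3 * (sigma n - n))%N.
Proof.
move=> n0 /dvdnP[k en]; rewrite {n}en in n0 *.
have := @sumn_divisors_le_sigma (k * 12) [seq k * d | d <- [:: 1; 2; 3; 4; 6; 12]]%N n0.
rewrite map_inj_in_uniq => [|x y _ _ /eqP]; last by rewrite eqn_pmul2l; [move/eqP | lia].
move=> /(_ isT); rewrite all_map => H.
have {}H : (sumn [seq (k * d)%N | d <- [:: 1; 2; 3; 4; 6; 12]] <= sigma (k * 12))%N.
  by apply: H; apply/allP => d d12 /=; rewrite dvdn_mul //; move: d d12; apply/allP.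
by rewrite /= in H; lia.
Qed.

Lemma aliquot_prime_square p : prime p -> (sigma (p ^ 2) - p ^ 2 = p.+1)%N.
Proof.
move=> pp; rewrite /sigma (perm_big _ (perm_divisors_pfactor 2 pp)) big_map.
by rewrite !big_cons big_nil /= expn0 expn1; lia.
Qed.

(** If [k = a * b] with [1 < a <= b], the proper divisor [a * b^2] of [k^2]
    satisfies [k^3 = a^3 * b^3 <= (a * b^2)^2]. *)
Lemma aliquot_composite_square k : (1 < k)%N -> ~~ prime k ->
  (k ^ 3 <= (sigma (k ^ 2) - k ^ 2) ^ 2)%N.
Proof.
move=> k1 npk; have k0 := ltnW k1.
have ppk := pdiv_prime k1; have := pdiv_dvd k.
have : (pdiv k ^ 2 <= k)%N by rewrite leqNgt; apply: contra npk; exact: ltn_pdiv2_prime.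
move: (pdiv k) ppk => a pa a2k /dvdnP[b ek].
have a1 := prime_gt1 pa.
have ab : (a <= b)%N by move: a2k; rewrite ek expnS expn1 leq_pmul2r // ltnW.
have b0 : (0 < b)%N by apply: leq_trans ab; apply: ltnW.
have abm : (a * b ^ 2 <= sigma (k ^ 2) - k ^ 2)%N.
  have k20 : (0 < k ^ 2)%N by rewrite expn_gt0 k0.
  have := @sumn_divisors_le_sigma (k ^ 2) [:: k ^ 2; a * b ^ 2]%N k20.
  have d1 : (a * b ^ 2 %| k ^ 2)%N by rewrite ek expnMn mulnC dvdn_pmul2l ?expn_gt0 ?b0 // dvdn_exp.
  have ne : (k ^ 2 != a * b ^ 2)%N.
    by rewrite ek expnMn mulnC eqn_pmul2r ?expn_gt0 ?b0 // -{2}(expn1 a) eqn_exp2l.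
  by rewrite /= dvdnn d1 inE ne => /(_ isT isT); lia.
apply: leq_trans (_ : (a * b ^ 2) ^ 2 <= _)%N; last by rewrite leq_sqr.
rewrite ek (_ : (b * a) ^ 3 = (a ^ 2 * b ^ 3) * a)%N; last by lia.
by rewrite (_ : (a * b ^ 2) ^ 2 = (a ^ 2 * b ^ 3) * b)%N ?leq_mul2l ?ab ?orbT //; lia.
Qed.

(** * Counting the nonaliquot multiples of 12 *)

(** The four cases are, in order: [n] even outside and inside the exceptional set
    of [density0_sigma12], [n] the square of a prime, and [n] the square of a
    composite number [k], for which [(k * t)^3 <= m^2 * N <= N^3]. *)
Lemma aliquot_multiple12 t N n m : (0 < n)%N -> (t ^ 3 <= N)%N ->
  (0 < m <= N)%N -> (12 %| m)%N -> m = (sigma n - n)%N ->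
  [\/ (12 %| n)%N /\ (n <= 3 * N %/ 4)%N,
      ~~ (12 %| sigma n)%N /\ (n <= 2 * N)%N,
      prime m.-1
    | exists2 k, n = (k ^ 2)%N & (k * t <= N)%N].
Proof.
move=> n0 tN /andP[m0 mN] m12 em; have ns := leq_sigma n0.
have es : sigma n = (m + n)%N by rewrite em subnK.
have om : ~~ odd m by rewrite -dvdn2; apply: dvdn_trans m12.
have [on|en] := boolP (odd n); last first.
  have n2 := aliquot_even_le n0 en; rewrite -em in n2.
  have [s12|s12] := boolP (12 %| sigma n)%N; last first.
    by apply: Or42; split=> //; lia.
  have n12 : (12 %| n)%N by move: s12; rewrite es dvdn_addr.
  by apply: Or41; split=> //; have := aliquot_dvd12_le n0 n12; rewrite -em; lia.
have os : odd (sigma n) by rewrite es oddD on (negbTE om).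
have [k ek] := odd_sigma_square n0 on os.
have k1 : (1 < k)%N.
  move: m0 n0; rewrite em ek; case: k {ek} => [|[|k]] //.
  by rewrite /sigma big_seq1.
have [pk|npk] := boolP (prime k).
  by apply: Or43; rewrite em ek aliquot_prime_square.
apply: Or44; exists k => //; rewrite -(@leq_exp2r (k * t) N 3) //.
rewrite expnMn (expnSr N 2); apply: leq_mul => //.
apply: leq_trans (aliquot_composite_square k1 npk) _.
by rewrite -ek -em leq_sqr.
Qed.

Lemma not_nonaliquot m : ~~ `[< nonaliquot m >] ->
  exists2 n, (0 < n)%N & m = (sigma n - n)%N.
Proof.
by move=> /asboolPn /existsNP[n] /not_implyP[n0 /contrapT ->]; exists n.
Qed.

(** Every multiple of 12 is nonaliquot or the image under one of four maps of
    an element of one of the sets of [aliquot_multiple12]. *)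
Lemma cnt_multiple12_le t N : (0 < t)%N -> (t ^ 3 <= N)%N ->
  (N %/ 12 <= cnt (fun m => `[< nonaliquot m >]) N + ((3 * N %/ 4) %/ 12 +
     cnt (fun n => ~~ (12 %| sigma n)%N) (2 * N) + cnt prime N + N %/ t))%N.
Proof.
move=> t0 tN; pose P m := `[< nonaliquot m >]; rewrite -/P.
pose s (n : nat) := (sigma n - n)%N.
pose E n := ~~ (12 %| sigma n)%N.
pose l := [seq m <- iota 1 N | P m] ++
  ([seq s n | n <- [seq n <- iota 1 (3 * N %/ 4) | 12 %| n]] ++
   [seq s n | n <- [seq n <- iota 1 (2 * N) | E n]] ++
   [seq p.+1 | p <- [seq p <- iota 1 N | prime p]] ++
   [seq s (k ^ 2) | k <- iota 1 (N %/ t)])%N.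
have szl : size l = (cnt P N + ((3 * N %/ 4) %/ 12 + cnt E (2 * N) + cnt prime N + N %/ t))%N.
  by rewrite /l !size_cat !size_map !size_filter size_iota -/(cnt _ _) -/(cnt (dvdn 12) _) cnt_dvdn !addnA.
rewrite -[leqRHS]szl -cnt_dvdn /cnt -size_filter.
apply: uniq_leq_size; first by rewrite filter_uniq ?iota_uniq.
move=> m; rewrite mem_filter mem_iota add1n ltnS => /andP[m12 mN].
rewrite mem_cat mem_filter mem_iota add1n ltnS mN andbT.
have [//|/not_nonaliquot[n n0 em]] := boolP (P m); rewrite /= !mem_cat.
have in_iota x M : (0 < x <= M)%N -> x \in iota 1 M by rewrite mem_iota add1n ltnS.
have [[n12 nN]|[n12 nN]|pm|[k ek kN]] := aliquot_multiple12 n0 tN mN m12 em.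
- apply/orP; left; apply/mapP; exists n => //.
  by rewrite mem_filter n12 in_iota ?n0.
- apply/orP; right; apply/orP; left; apply/mapP; exists n => //.
  by rewrite mem_filter /E n12 in_iota ?n0.
- apply/orP; right; apply/orP; right; apply/orP; left; apply/mapP; exists m.-1.
    by rewrite mem_filter pm in_iota // prime_gt0 //=; lia.
  by rewrite prednK //; case/andP: mN.
- apply/orP; right; apply/orP; right; apply/orP; right; apply/mapP; exists k.
    apply: in_iota; rewrite leq_divRL // kN andbT; move: n0; rewrite ek.
    by case: k {ek kN}.
  by rewrite em ek.
Qed.

(** [N/12 - N/16 = N/48], and the three remaining terms of [cnt_multiple12_le] are
    [o(N)]. *)
Lemma nonaliquot_cnt_lower k : exists N0, forall N, (N0 <= N)%N ->
  (k * N <= 48 * k * cnt (fun m => `[< nonaliquot m >]) N + N)%N.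
Proof.
(* The error terms sum to at most [4 * N / K], that is [192 * N / K] after
   scaling by 48, and one more [N / K] absorbs the rounding of the quotients. *)
pose K := (193 * k.+1)%N.
have [N1 H1] := density0_sigma12 K; have [N2 H2] := density0_prime K.
exists (maxn (N1 + N2) (K ^ 3 + 44 * K)) => N; rewrite geq_max => /andP[h1 h2].
have := H1 (2 * N)%N; have := H2 N.
have : (N %/ K * K <= N)%N := leq_trunc_div N K.
have := cnt_multiple12_le (t := K) (N := N).
move: (cnt (fun m => `[< nonaliquot m >]) N) (cnt _ (2 * N)) (cnt prime N) (N %/ K)%N => c e p d.
move=> /(_ isT) H3 H4 H5 H6.
have {}H3 := H3 (leq_trans (leq_addr _ _) h2).
have {}H5 : (K * p <= N)%N by apply: H5; lia.
have {}H6 : (K * e <= 2 * N)%N by apply: H6; lia.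
have : (N <= 48 * c + 48 * e + 48 * p + 48 * d + 44)%N by lia.
move: h2; rewrite /K in H4 H5 H6 *; move: (K ^ 3)%N => *.
nia.
Qed.

(** * From integers to real numbers *)

Lemma cnt_le_nonaliquot_count (R : realType) (x : R) : 0 <= x ->
  (cnt (fun m => `[< nonaliquot m >]) (Num.truncn x) <= nonaliquot_count x)%N.
Proof.
move=> x0; rewrite /cnt -size_filter; apply: uniq_leq_size => [|m].
  by rewrite filter_uniq ?iota_uniq.
rewrite mem_filter mem_iota add1n ltnS.
move=> /andP[/asboolP nm /andP[m0 mx]].
rewrite in_fset_set; last exact: finite_nonaliquots.
by rewrite inE; split=> //; split=> //; rewrite -truncn_ge_nat.
Qed.

Local Open Scope classical_set_scope.

Theorem theorem2 (R : realType) :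
  exists eps : R -> R,
    (eps x @[x --> +oo] --> (0 : R)) /\
    (\forall x \near +oo,
       x / 48%:R * (1 + eps x) <= (nonaliquot_count x)%:R).
Proof.
(* The relative error of the count, truncated above so that it tends to zero. *)
exists (fun x => Num.min 0 (48 * (nonaliquot_count x)%:R / x - 1)); split; last first.
  near=> x.
  have x0 : 0 < x by near: x; apply: nbhs_pinfty_gt; rewrite num_real.
  apply: (@le_trans _ _ (x / 48%:R * (1 + (48 * (nonaliquot_count x)%:R / x - 1)))).
    by rewrite ler_pM2l ?divr_gt0 // lerD2l ge_min lexx orbT.
  rewrite addrC subrK le_eqVlt; apply/orP; left; apply/eqP; field.
  by rewrite gt_eqF.
apply/cvgrPdist_le => e e0.
(* The lower bound falls short of 1 by at most [1 / k + 1 / x]. *)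
pose k := (Num.truncn (2 / e)).+1.
have kE : 2 / e <= k%:R by rewrite ltW // truncnS_gt.
have [N0 HN] := nonaliquot_cnt_lower k.
near=> x.
have x0 : 0 < x by near: x; apply: nbhs_pinfty_gt; rewrite num_real.
have xe : 2 / e <= x by near: x; apply: nbhs_pinfty_ge; rewrite num_real.
have xN : N0%:R <= x by near: x; apply: nbhs_pinfty_ge; rewrite num_real.
rewrite sub0r normrN ler0_norm ?ge_min ?lexx // lerNl le_min oppr_le0 (ltW e0) /=.
rewrite lerBrDr ler_pdivlMr //.
have := HN (Num.truncn x); rewrite truncn_ge_nat ?(ltW x0) // => /(_ xN).
have := cnt_le_nonaliquot_count (ltW x0).
have := truncnS_gt x; rewrite -natr1.
have : (Num.truncn x)%:R <= x by rewrite truncn_le // (ltW x0).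
move: (Num.truncn x) (nonaliquot_count x) (cnt _ _) => N C c Nx xN1 cC.
rewrite -(ler_nat R) natrD 3!natrM => H.
have {}cC : c%:R <= C%:R :> R by rewrite ler_nat.
have k0 : 0 < k%:R :> R by rewrite ltr0n.
rewrite ler_pdivrMr // in kE; rewrite ler_pdivrMr // in xe.
have H1 : k%:R * (x - 1) <= 48 * k%:R * C%:R + x :> R.
  have : k%:R * (x - 1) <= k%:R * N%:R :> R by rewrite ler_pM2l //; lra.
  have : 48 * k%:R * c%:R <= 48 * k%:R * C%:R :> R by rewrite ler_wpM2l //; lra.
  lra.
rewrite -(ler_pM2l k0).
have : 2 * x <= k%:R * e * x by rewrite ler_pM2r.
have : 2 * k%:R <= x * e * k%:R by rewrite ler_pM2r.
lra.
Unshelve. all: by end_near.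
Qed.
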